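(* Let $\beta>1$, let $X$ be the (two-sided) $\beta$-shift, and let $r\colon X\to(0,\infty)$ be a roof function satisfying the Walters property. Then the suspension flow over $(X,\sigma)$ with roof function $r$ is not topologically mixing if and only if there exists a $\delta>0$ such that for every periodic point $p\in[0]=\{x\in X: x_0=0\}$ we have $$\sum_{j=0}^{\mathrm{per}(p)-1} r(\sigma^j p)\in\delta\mathbb{Z},$$ where $\mathrm{per}(p)$ is the period of $p$ under the shift map $\sigma$.
   Context: $\beta$-shift: for $\beta>1$ let $T_\beta\colon[0,1]\to[0,1]$, $T_\beta(x)=\beta x \bmod 1$. The $\beta$-expansion of $x\in[0,1]$ is the sequence $(a_n)_{n\ge1}$ with $a_n=\lfloor\beta T_\beta^{n-1}(x)\rfloor\in\{0,1,\dots,\lfloor\beta\rfloor\}$. The one-sided $\beta$-shift is the closure in $\{0,\dots,\lfloor\beta\rfloor\}^{\mathbb{N}}$ of the set of all $\beta$-expansions of points $x\in[0,1]$. The two-sided $\beta$-shift is its usual two-sided extension, i.e. the set of $x\in\{0,\dots,\lfloor\beta\rfloor\}^{\mathbb{Z}}$ such that for every $n\in\mathbb{Z}$ the one-sided sequence $x_nx_{n+1}x_{n+2}\cdots$ belongs to the one-sided $\beta$-shift. It carries the metric $d(x,y)=2^{-\min\{|n|: x_n\neq y_n\}}$ and the left shift $(\sigma x)_n=x_{n+1}$. Write $x_{[i,j]}=x_i\cdots x_j$. A function $r\colon X\to\mathbb{R}$ satisfies the Walters property if for every $\varepsilon>0$ there is $k\ge 0$ such that for all $n\in\mathbb{N}$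 and all $x,y\in X$ with $x_{[-k,n+k]}=y_{[-k,n+k]}$ we have $\left|\sum_{j=0}^{n-1}\big(r(\sigma^jx)-r(\sigma^jy)\big)\right|<\varepsilon$. Suspension flow: given $r\colon X\to(0,\infty)$, let $M_r=\{(x,t)\in X\times[0,\infty): 0\le t\le r(x)\}/\sim$, with the quotient topology, where $(x,r(x))\sim(\sigma x,0)$. The suspension flow is $\varphi^T(x,s)=(\sigma^n x,s')$, where $n$ and $s'$ satisfy $\sum_{j=0}^{n-1}r(\sigma^jx)+s'=T+s$ and $0\le s'\le r(\sigma^nx)$. It is topologically mixing if for all nonempty open $U,V\subset M_r$ there is $T\in\mathbb{R}$ such that $\varphi^t(U)\cap V\neq\emptyset$ for all $t\ge T$. *)

(* Defs.v *)
From HB Require Import structures.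
From Stdlib Require Import Relation_Operators Operators_Properties.
From mathcomp Require Import all_boot all_order all_algebra.
From mathcomp Require Import all_classical all_reals all_analysis.

Set Implicit Arguments.
Unset Strict Implicit.
Unset Printing Implicit Defensive.

Import Order.TTheory GRing.Theory Num.Theory.
Import numFieldNormedType.Exports.
Local Open Scope classical_set_scope.
Local Open Scope ring_scope.

Section BetaExpansions.
Variables (R : realType) (beta : R).

Definition digit : Type := 'I_(Num.truncn beta).+1.

Definition beta_map (x : R) : R := beta * x - (Num.floor (beta * x))%:~R.

(* Sequences are indexed from 0: the n-th entry is the digit written a_(n+1)
   when indexing from 1. [inord] never truncates for x in [0, 1], see
   [beta_expansionE]. *)
Definition beta_expansion (x : R) : {ptws nat -> discrete_topology digit} :=
  fun n => inord (Num.truncn (beta * iter n beta_map x)).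

Definition one_sided_beta_shift : set {ptws nat -> discrete_topology digit} :=
  closure [set beta_expansion x | x in `[0, 1]].

Definition two_sided_beta_shift : set (int -> digit) :=
  [set x | forall n : int, one_sided_beta_shift (fun j : nat => x (n + j%:Z))].

Definition beta_shift : Type := set_type two_sided_beta_shift.

Definition coord (x : beta_shift) : int -> digit := \val x.

Lemma iter_beta_map_itv (x : R) n : 0 <= x <= 1 ->
  0 <= iter n beta_map x <= 1.
Proof.
elim: n => //= n IH /IH _.
rewrite /beta_map; set y := beta * _.
have := Num.Theory.ge_floor y; have := Num.Theory.floorD1_gt y.
rewrite intrD => h1 h2.
by rewrite subr_ge0 h2 /= lerBlDl ltW.
Qed.

Lemma beta_expansionE (x : R) n : 0 < beta -> 0 <= x <= 1 ->
  nat_of_ord (beta_expansion x n : digit)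
    = Num.truncn (beta * iter n beta_map x).
Proof.
move=> b0 /(iter_beta_map_itv n) /andP[h0 h1].
rewrite inordK // ltnS le_truncn //.
by rewrite -[leRHS]mulr1 ler_wpM2l // ltW.
Qed.

End BetaExpansions.

Arguments one_sided_beta_shift {R} beta _.
Arguments two_sided_beta_shift {R} beta _.

Coercion coord : beta_shift >-> Funclass.

Section Metric.
Variables (R : realType) (beta : R).
Implicit Types x y z : beta_shift beta.

Lemma coord_inj x y : (forall i, x i = y i) -> x = y.
Proof. by move=> h; apply/val_inj/funext. Qed.

Definition differ_at x y (m : nat) : bool :=
  `[< exists i : int, `|i|%N = m /\ x i <> y i >].

Definition shift_dist x y : R :=
  if pselect (exists m, differ_at x y m) is left h then 2 ^- ex_minn h else 0.

Lemma shift_dist_ge x y (i : int) : x i <> y i -> 2 ^- `|i|%N <= shift_dist x y.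
Proof.
move=> h; have hd : differ_at x y `|i|%N by apply/asboolP; exists i.
rewrite /shift_dist; case: pselect => [e|[]]; last by exists `|i|%N.
case: ex_minnP => m _ /(_ _ hd) le_m.
by rewrite lef_pV2 ?posrE ?exprn_gt0 // ler_eXn2l // ltr1n.
Qed.

Lemma shift_distP x y : (x = y /\ shift_dist x y = 0) \/
  exists i : int, x i <> y i /\ shift_dist x y = 2 ^- `|i|%N.
Proof.
rewrite /shift_dist; case: pselect => [e|ne].
  case: ex_minnP => m /asboolP[i [im h]] _.
  by right; exists i; rewrite im.
left; split=> //; apply: coord_inj => i.
apply: contrapT => h; apply: ne; exists `|i|%N.
by apply/asboolP; exists i.
Qed.

Lemma shift_dist_ge0 x y : 0 <= shift_dist x y.
Proof.
have [[_ ->] //|[i [_ ->]]] := shift_distP x y.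
by rewrite invr_ge0 exprn_ge0.
Qed.

Lemma shift_distxx x : shift_dist x x = 0.
Proof. by have [[_ ->] //|[i [/(_ erefl)]]] := shift_distP x x. Qed.

Lemma shift_dist_positivity x y : shift_dist x y = 0 -> x = y.
Proof.
have [[-> _] //|[i [_ ->]]] := shift_distP x y.
by move=> /eqP; rewrite invr_eq0 expf_eq0 pnatr_eq0 andbF.
Qed.

Lemma shift_dist_sym x y : shift_dist x y = shift_dist y x.
Proof.
suff le u v : shift_dist u v <= shift_dist v u by apply/eqP; rewrite eq_le !le.
have [[-> _] //|[i [ne ->]]] := shift_distP u v.
by apply: shift_dist_ge => /esym.
Qed.

Lemma shift_dist_triangle y x z :
  shift_dist x z <= shift_dist x y + shift_dist y z.
Proof.
have [[_ ->]|[i [ne ->]]] := shift_distP x z.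
  by rewrite addr_ge0 ?shift_dist_ge0.
have [xy|xy] := pselect (x i = y i); last first.
  by rewrite ler_wpDr ?shift_dist_ge0 // shift_dist_ge.
by rewrite ler_wpDl ?shift_dist_ge0 // shift_dist_ge // -xy.
Qed.

HB.instance Definition _ := gen_eqMixin (beta_shift beta).
HB.instance Definition _ := gen_choiceMixin (beta_shift beta).
HB.instance Definition _ := @isMetric.Build R (beta_shift beta) shift_dist
  shift_distxx shift_dist_positivity shift_dist_sym shift_dist_triangle.

End Metric.

Section Shift.
Variables (R : realType) (beta : R).

Lemma shiftz_subproof (n : int) (x : beta_shift beta) :
  (fun i => x (i + n)) \in two_sided_beta_shift beta.
Proof.
rewrite inE => m /=; have := set_valP x => /(_ (m + n)).
by rewrite (_ : (fun _ => _) = (fun j : nat => x (m + j%:Z + n))) //;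
  apply/funext => j; rewrite /coord addrAC.
Qed.

(* the power sigma^n of the left shift, for n in Z *)
Definition shiftz (n : int) (x : beta_shift beta) : beta_shift beta :=
  exist (fun y => y \in two_sided_beta_shift beta) _ (shiftz_subproof n x).

Definition left_shift : beta_shift beta -> beta_shift beta := shiftz 1.

Lemma shiftz_nat (n : nat) x : shiftz n x = iter n left_shift x.
Proof.
elim: n => [|n IH] /=.
  by apply: coord_inj => i; rewrite /coord /= addr0.
rewrite -IH; apply: coord_inj => i.
by rewrite /coord /= /coord /= -addrA -intS.
Qed.

Lemma shiftzD (m n : int) x : shiftz m (shiftz n x) = shiftz (m + n) x.
Proof. by apply: coord_inj => i; rewrite /coord /= /coord /= addrA. Qed.

Definition periodic_point (p : beta_shift beta) : Prop :=
  exists n, (0 < n)%N && (iter n left_shift p == p).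

(* the least period; 0 when p is not periodic *)
Definition least_period (p : beta_shift beta) : nat :=
  if pselect (periodic_point p) is left h then ex_minn h else 0%N.

Definition walters (r : beta_shift beta -> R) : Prop :=
  forall eps : R, 0 < eps -> exists k : nat, forall (n : nat) (x y : beta_shift beta),
    (forall i : int, - k%:Z <= i <= n%:Z + k%:Z -> x i = y i) ->
    `| \sum_(j < n) (r (iter j left_shift x) - r (iter j left_shift y)) | < eps.

End Shift.

Section Suspension.
Variables (R : realType) (beta : R) (r : beta_shift beta -> R).

Definition under_roof : Type :=
  set_type [set xt : beta_shift beta * R | 0 <= xt.2 <= r xt.1].

HB.instance Definition _ := Topological.on under_roof.

Definition base_point (u : under_roof) : beta_shift beta := (\val u).1.
Definition height (u : under_roof) : R := (\val u).2.

Definition glue_top (u v : under_roof) : Prop :=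
  [/\ height u = r (base_point u), base_point v = left_shift (base_point u) & height v = 0].

Definition glue_equiv (u v : under_roof) : bool :=
  `[< clos_refl_sym_trans under_roof glue_top u v >].

Lemma glue_equiv_refl : reflexive glue_equiv.
Proof. by move=> u; apply/asboolP; exact: rst_refl. Qed.

Lemma glue_equiv_sym : symmetric glue_equiv.
Proof.
by move=> u v; apply/asboolP/asboolP; exact: rst_sym.
Qed.

Lemma glue_equiv_trans : transitive glue_equiv.
Proof.
move=> v u w /asboolP uv /asboolP vw.
by apply/asboolP; apply: rst_trans uv vw.
Qed.

Canonical glue_equivRel :=
  EquivRel glue_equiv glue_equiv_refl glue_equiv_sym glue_equiv_trans.

Definition suspension : Type :=
  quotient_topology {eq_quot glue_equivRel}%qT.

HB.instance Definition _ := Topological.on suspension.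

Definition suspension_pi (u : under_roof) : suspension :=
  (\pi_(quotient_topology {eq_quot glue_equivRel}) u)%qT.

(* the cocycle sum_(0 <= j < n) r (sigma^j x), with the usual convention
   - sum_(n <= j < 0) r (sigma^j x) for n < 0 *)
Definition birkhoff (x : beta_shift beta) (n : int) : R :=
  match n with
  | Posz m => \sum_(j < m) r (shiftz j%:Z x)
  | Negz m => - \sum_(j < m.+1) r (shiftz (- j.+1%:Z) x)
  end.

(* The graph of the time-t map: [suspension_flow t p q] says that q is the
   image of p. The bounds 0 <= s' <= r (sigma^n x) are part of
   [v : under_roof]. *)
Definition suspension_flow (t : R) (p q : suspension) : Prop :=
  exists (u v : under_roof) (n : int),
    [/\ p = suspension_pi u, q = suspension_pi v,
        base_point v = shiftz n (base_point u) &
        birkhoff (base_point u) n + height v = t + height u].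

Definition flow_image (t : R) (U : set suspension) : set suspension :=
  [set q | exists2 p, U p & suspension_flow t p q].

Definition topologically_mixing : Prop :=
  forall U V : set suspension, open U -> open V -> U !=set0 -> V !=set0 ->
    exists T : R, forall t : R, T <= t -> flow_image t U `&` V !=set0.

End Suspension.

(* Main.v *)
(* A two-sided sequence x lies in the beta-shift iff every finite block of it has
   value sum_j x_(i+j) / beta^(j+1) < 1. Hence a word may be followed by any
   admissible sequence once it is closed, i.e. all its suffixes u satisfy
   value u + beta^-|u| <= 1, and both finitely supported words and blocks of a
   periodic point become closed after finitely many zeros.

   If all periods through [0] lie in delta Z, an orbit segment of x from a small
   cylinder around 0^oo back to it is shadowed by a periodic point, so by the
   Walters property its Birkhoff sum is close to delta Z; a small box over 0^oo
   then misses itself at the times delta (m + 1/2). If they lie in no delta Z,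
   pigeonhole gives for every eta a periodic point p such that the numbers
   m1 (period of p) + m2 r(0^oo) are eventually eta-dense; inserting m1 copies of
   p and m2 zeros in a connecting word changes its Birkhoff sum by that amount up
   to an error independent of m1 and m2. *)
From Stdlib Require Import Relation_Operators.
Require Import Defs.
From mathcomp Require Import all_boot all_order all_algebra.
From mathcomp Require Import all_classical all_reals all_analysis.
From mathcomp Require Import zify ring lra.

Import Order.TTheory GRing.Theory Num.Theory.
Import numFieldNormedType.Exports.
Local Open Scope classical_set_scope.
Local Open Scope ring_scope.

Set Implicit Arguments.
Unset Strict Implicit.
Unset Printing Implicit Defensive.

(** * Sequences of the beta-shift *)

Section PointwiseClosure.
Variable D : choiceType.
Implicit Types (E : set {ptws nat -> discrete_topology D}) (f : nat -> D).

(** Fixing the first [n] entries is a finite intersection of neighbourhoods of [f]; conversely,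
    approximants chosen for every [n] converge to [f] pointwise. *)
Lemma ptws_closure_discrete E f :
  closure E f <-> forall n, exists2 g, E g & forall j, (j < n)%N -> g j = f j.
Proof.
split=> [clEf n|h].
  have cv (t : nat) : nbhs (f : {ptws nat -> discrete_topology D})
      [set g | g t = f t].
    have h : {ptws, nbhs (f : {ptws nat -> discrete_topology D}) -->
        (f : nat -> discrete_topology D)} by [].
    have [/(_ h) {}h _] := @pointwise_cvgP _ (discrete_topology D) (nbhs (f : {ptws nat -> discrete_topology D})) f _.
    exact: (h t _ (discrete_set1 (f t : discrete_topology D))).
  have nb : nbhs (f : {ptws nat -> discrete_topology D})
      [set g | forall j : 'I_n, g j = f j].
    exact: (@filter_forall _ _
      (fun (j : 'I_n) (g : {ptws nat -> discrete_topology D}) => g j = f j) _ _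
      (fun j => cv j)).
  have [g [Eg gf]] := clEf _ nb.
  by exists g => // j jn; exact: (gf (Ordinal jn)).
have /choice [u uP] n : exists g, E g /\ forall j, (j < n)%N -> g j = f j.
  by have [g ? ?] := h n; exists g.
have cv : (u : nat -> {ptws nat -> discrete_topology D}) @ \oo -->
    (f : {ptws nat -> discrete_topology D}).
  have [_] := @pointwise_cvgP _ (discrete_topology D) (u @ \oo) f _.
  apply=> t; apply/(@discrete_cvg (discrete_topology D)).
  by exists t.+1 => //= n tn; have [_] := uP n; apply.
move=> B /cv [N _ NB].
by exists (u N); split; [have [] := uP N|apply: NB => /=].
Qed.

End PointwiseClosure.

Lemma periodic_mul (x : int -> nat) (P : int) : (forall i, x (i + P) = x i) ->
  forall (q i : int), x (i + q * P) = x i.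
Proof.
move=> per; elim/int_ind => [|n IH|n IH] i.
- by rewrite mul0r addr0.
- by rewrite -[n.+1]addn1 PoszD mulrDl mul1r addrA per.
- by rewrite -(per (i + _)) -addrA -{2}[P]mul1r -mulrDl (_ : _ + 1 = - n%:Z) ?IH //; lia.
Qed.

Section Expansions.
Variables (R : realType) (beta : R).
Hypothesis hbeta : 1 < beta.
Implicit Types (x y z : int -> nat) (i : int) (m n : nat).

Definition bval z i n : R := \sum_(j < n) (z (i + j%:Z))%:R * beta ^- j.+1.

(** Takes the place of the lexicographic comparison with the expansion of 1. Blocks of length 1
    already bound the digits, so sequences may be [nat]-valued. *)
Definition admissible z := forall i n, bval z i n < 1.

Let b0 : 0 < beta. Proof. exact: lt_trans hbeta. Qed.

Lemma pow_beta_gt0 n : 0 < beta ^- n.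
Proof. by rewrite invr_gt0 exprn_gt0. Qed.

Lemma pow_beta_le1 n : beta ^- n <= 1.
Proof. by rewrite invf_le1 ?exprn_gt0 // exprn_ege1 // ltW. Qed.

Lemma bval0 z i : bval z i 0 = 0.
Proof. by rewrite /bval big_ord0. Qed.

Lemma bval_ge0 z i n : 0 <= bval z i n.
Proof. by apply: sumr_ge0 => j _; rewrite mulr_ge0 // ltW // pow_beta_gt0. Qed.

Lemma bvalD z i m n :
  bval z i (m + n) = bval z i m + beta ^- m * bval z (i + m%:Z) n.
Proof.
rewrite /bval big_split_ord /=; congr (_ + _).
rewrite mulr_sumr; apply: eq_bigr => j _ /=.
rewrite -addnS exprD invfM PoszD addrA; ring.
Qed.

Lemma bval1 z i : bval z i 1 = (z i)%:R / beta.
Proof. by rewrite /bval big_ord1 addr0 expr1. Qed.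

Lemma bvalS z i n : beta * bval z i n.+1 = (z i)%:R + bval z (i + 1) n.
Proof.
rewrite -add1n bvalD bval1 expr1.
have : beta != 0 by rewrite gt_eqF.
by move=> ?; field.
Qed.

Lemma eq_bval x y i i' n :
    (forall j, (j < n)%N -> x (i + j%:Z) = y (i' + j%:Z)) ->
  bval x i n = bval y i' n.
Proof. by move=> h; apply: eq_bigr => j _; rewrite h. Qed.

Lemma bval_leq z i m n : (m <= n)%N -> bval z i m <= bval z i n.
Proof.
move=> /subnK <-; rewrite addnC bvalD lerDl.
by rewrite mulr_ge0 ?bval_ge0 // ltW // pow_beta_gt0.
Qed.

Lemma bval_zero z i n : (forall j, (j < n)%N -> z (i + j%:Z) = 0) -> bval z i n = 0.
Proof. by move=> h; rewrite /bval big1 // => j _; rewrite h // mul0r. Qed.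

Lemma bval_nonzero z i n j : (j < n)%N -> z (i + j%:Z) != 0 ->
  beta ^- n <= bval z i n.
Proof.
move=> jn zj; rewrite /bval (bigD1 (Ordinal jn)) //=.
rewrite ler_wpDr ?sumr_ge0 // => [k _|].
  by rewrite mulr_ge0 // ltW // pow_beta_gt0.
rewrite -[leLHS]mul1r; apply: ler_pM => //.
- by rewrite ltW // pow_beta_gt0.
- by rewrite ler1n lt0n.
- by rewrite lef_pV2 ?posrE ?exprn_gt0 // ler_weXn2l // ltW.
Qed.

Lemma admissible_digit z i : admissible z -> (z i < (Num.truncn beta).+1)%N.
Proof.
move=> /(_ i 1); rewrite bval1 ltr_pdivrMr // mul1r => /ltW.
by rewrite ltnS truncn_ge_nat // ltW.
Qed.

Lemma beta_map_itv (t : R) : 0 <= beta_map beta t < 1.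
Proof.
rewrite /beta_map subr_ge0 Num.Theory.ge_floor /= ltrBlDl.
by have := Num.Theory.floorD1_gt (beta * t); rewrite intrD.
Qed.

Lemma beta_map_truncn (t : R) : 0 <= t ->
  beta_map beta t = beta * t - (Num.truncn (beta * t))%:R.
Proof.
move=> t0; rewrite /beta_map; congr (_ - _).
have bt0 : 0 <= beta * t by rewrite mulr_ge0 // ltW.
rewrite truncn_floor bt0 natr_absz ger0_norm //.
by rewrite floor_ge0.
Qed.

Definition expansion_digits (t : R) : int -> nat :=
  fun i => nat_of_ord (beta_expansion beta t `|i|%N : digit beta).

(** The relation [s = (digit + T s) / beta] is iterated along the orbit of [t]. *)
Lemma beta_expansion_bval (t : R) m n : 0 <= t <= 1 ->
  bval (expansion_digits t) m n
    = iter m (beta_map beta) t - beta ^- n * iter (m + n) (beta_map beta) t.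
Proof.
move=> t01; elim: n => [|n IH]; first by rewrite bval0 addn0 expr0 invr1 mul1r subrr.
rewrite -addn1 bvalD IH bval1 -PoszD /expansion_digits absz_nat.
rewrite beta_expansionE // addnA addn1 addnS addn0 iterS.
set s := iter (m + n) _ _.
have /andP[s0 _] : 0 <= s <= 1 by exact: iter_beta_map_itv.
rewrite beta_map_truncn // exprS.
have : beta != 0 by rewrite gt_eqF.
have : beta ^+ n != 0 by rewrite expf_neq0 ?gt_eqF.
by move=> ? ?; field; apply/andP.
Qed.

(** The start [m.+1] matters: images under [beta_map] lie in [0, 1), but [t] itself may be 1. *)
Lemma bval_expansion_tail (t : R) m n : 0 <= t <= 1 -> bval (expansion_digits t) m.+1 n < 1.
Proof.
move=> t01; rewrite beta_expansion_bval //.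
rewrite iterS; have /andP[_ h] := beta_map_itv (iter m (beta_map beta) t).
apply: le_lt_trans h; rewrite gerBl mulr_ge0 ?(ltW (pow_beta_gt0 n)) //.
by have /andP[] := iter_beta_map_itv beta (m.+1 + n) t01.
Qed.

(** The remaining block has value below 1, so the floor removes exactly the leading digit. *)
Lemma iter_beta_map_bval x i m n : admissible x ->
  iter m (beta_map beta) (bval x i (m + n)) = bval x (i + m%:Z) n.
Proof.
move=> adm; elim: m n => [|m IH] n; first by rewrite addr0.
rewrite iterS addSnnS IH -[m.+1]addn1 PoszD addrA /beta_map bvalS.
rewrite (_ : Num.floor _ = x (i + m%:Z)).
  by rewrite -pmulrn [X in X - _]addrC addrK.
apply: floor_def; rewrite intrD -pmulrn lerDl bval_ge0 /= ltrD2l.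
exact: adm.
Qed.

Lemma expansion_bval_digit x i m n : admissible x -> (m < n)%N ->
  beta_expansion beta (bval x i n) m = x (i + m%:Z) :> nat.
Proof.
move=> adm mn; rewrite beta_expansionE //; last by rewrite bval_ge0 ltW.
have [l ->] : exists l, n = (m + l.+1)%N by exists (n - m).-1; lia.
rewrite iter_beta_map_bval // bvalS; apply: truncn_def.
by rewrite lerDl bval_ge0 /= -natr1 ltrD2l; exact: adm.
Qed.

Lemma admissible_two_sidedP (z : int -> digit beta) :
  two_sided_beta_shift beta z <-> admissible (fun i => z i).
Proof.
split=> [zX i n|adm i].
  (* Reading from [i - 1] puts the block at index 1 of the expansion, as the tail bound requires. *)
  have /ptws_closure_discrete /(_ n.+1) [_ [t /= t01 <-] tz] := zX (i - 1).
  rewrite in_itv /= in t01.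
  apply: le_lt_trans (@bval_expansion_tail t 0 n t01).
  rewrite (@eq_bval _ (expansion_digits t) i 1) // => j jn.
  rewrite /expansion_digits -PoszD absz_nat add1n; congr nat_of_ord.
  rewrite [RHS]tz //; congr z; lia.
apply/ptws_closure_discrete => n.
exists (beta_expansion beta (bval (fun i => z i) i n)).
  by exists (bval (fun i => z i) i n); rewrite //= in_itv /= bval_ge0 ltW.
by move=> j jn; apply: ord_inj; apply: expansion_bval_digit.
Qed.

(** * Splicing, closed words and periodization *)

Definition splice x (n : int) y : int -> nat :=
  fun i => if i < n then x i else y (i - n).

Definition zeros : int -> nat := fun=> 0%N.

(* After a closed word every admissible sequence may follow: the word leads back to
   the initial vertex of the graph of the beta-shift. *)
Definition closed_at x (n : int) :=
  forall l : nat, bval x (n - l%:Z) l + beta ^- l <= 1.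

Lemma admissible_zeros : admissible zeros.
Proof. by move=> i n; rewrite bval_zero // ltr01. Qed.

Lemma admissible_shift z (k : int) :
  admissible z -> admissible (fun i => z (i + k)).
Proof.
move=> adm i n; rewrite -(@eq_bval z _ (i + k)) // => j _.
by rewrite addrAC.
Qed.

Lemma closed_zeros (n : int) : closed_at zeros n.
Proof. by move=> l; rewrite bval_zero // add0r pow_beta_le1. Qed.

Lemma closed_bval_lt1 x (n : int) i m : closed_at x n -> i + m%:Z <= n -> bval x i m < 1.
Proof.
move=> cl imn; have := cl `|n - i|%N.
have -> : n - `|n - i|%N%:Z = i by lia.
apply: lt_le_trans; apply: (@le_lt_trans _ _ (bval x i `|n - i|%N)).
  by apply: bval_leq; lia.
by rewrite ltrDl pow_beta_gt0.
Qed.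

(** A block straddling [n] has value [v + beta ^- l * w] with [w < 1], and [v + beta ^- l <= 1] by
    closedness. *)
Lemma admissible_splice x (n : int) y :
  closed_at x n -> admissible y -> admissible (splice x n y).
Proof.
move=> cl adm i m; have [ni|ni] := leP n i.
  rewrite (@eq_bval _ y _ (i - n)) // => j _.
  rewrite /splice ifF; last by lia.
  by congr y; lia.
have [le|gt] := leP (i + m%:Z) n.
  rewrite (@eq_bval _ x _ i); first exact: closed_bval_lt1 cl le.
  by move=> j jm; rewrite /splice ifT //; lia.
have [l [k [nE mE]]] : exists l k : nat, n = i + l%:Z /\ m = (l + k)%N.
  by exists `|n - i|%N, (m - `|n - i|)%N; lia.
rewrite mE bvalD -nE (@eq_bval _ x _ i); last first.
  by move=> j jm; rewrite /splice ifT //; lia.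
rewrite (@eq_bval _ y n 0); last first.
  by move=> j jm; rewrite /splice ifF; [congr y|]; lia.
have := cl l; rewrite nE addrK; apply: lt_le_trans.
by rewrite ltrD2l -[ltRHS]mulr1 ltr_pM2l ?pow_beta_gt0.
Qed.

Lemma closed_skip x (n : int) (e l : nat) :
  (forall j, (j < e)%N -> x (n - (e + l)%:Z + j%:Z) = 0%N) ->
  bval x (n - l%:Z) l + beta ^- l <= 1 ->
  bval x (n - (e + l)%:Z) (e + l) + beta ^- (e + l) <= 1.
Proof.
move=> x0 h; rewrite bvalD bval_zero // add0r exprD invfM.
rewrite (_ : _ + e%:Z = n - l%:Z); last by lia.
rewrite -mulrDr mulr_ile1 ?pow_beta_le1 ?(ltW (pow_beta_gt0 _)) //.
by rewrite addr_ge0 ?bval_ge0 ?(ltW (pow_beta_gt0 _)).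
Qed.

Lemma pow_beta_small (g : R) : 0 < g -> exists M : nat, beta ^- M <= g.
Proof.
move=> g0; have /cvgrPdist_lt /(_ _ g0) [N _ /(_ N (leqnn N))] :
    (fun n : nat => beta^-1 ^+ n) @ \oo --> (0 : R).
  apply: cvg_expr; rewrite ger0_norm ?invr_ge0 ?ltW //.
  by rewrite invf_lt1.
rewrite /= sub0r normrN exprVn ger0_norm ?(ltW (pow_beta_gt0 _)) // => h.
by exists N; exact: ltW.
Qed.

Lemma pow_beta_leq m n : (m <= n)%N -> beta ^- n <= beta ^- m.
Proof. by move=> mn; rewrite lef_pV2 ?posrE ?exprn_gt0 // ler_weXn2l // ltW. Qed.

Lemma splice_zeros_ge x (n : int) i : n <= i -> splice x n zeros i = 0%N.
Proof. by rewrite /splice ltNge => ->. Qed.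

(* Only finitely many tails of a finitely supported word matter, and each
   leaves a positive gap below 1. *)
Lemma closed_at_finite x (a n : int) : admissible x -> (forall i, i < a -> x i = 0%N) ->
  exists M0 : nat, forall M : nat, (M0 <= M)%N -> closed_at (splice x n zeros) (n + M%:Z).
Proof.
move=> adm xa.
have gap (N : nat) : exists M0 : nat, forall l, (l <= N)%N -> bval x (n - l%:Z) l + beta ^- M0 <= 1.
  elim: N => [|N [M0 IH]].
    by exists 0%N => l; rewrite leqn0 => /eqP ->; rewrite bval0 add0r pow_beta_le1.
  have [M1 M1P] : exists M1, beta ^- M1 <= 1 - bval x (n - N.+1%:Z) N.+1.
    by apply: pow_beta_small; rewrite subr_gt0.
  exists (maxn M0 M1) => l; rewrite leq_eqVlt => /predU1P[->|lN].
    rewrite -lerBrDl (le_trans _ M1P) // pow_beta_leq //; exact: leq_maxr.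
  apply: le_trans (IH l lN); rewrite lerD2l pow_beta_leq //; exact: leq_maxl.
have [M0 M0P] := gap `|n - a|%N.
exists M0 => M M0M.
have small (l : nat) : (l <= `|n - a|%N)%N ->
    bval (splice x n zeros) (n + M%:Z - (l + M)%:Z) (l + M) + beta ^- (l + M) <= 1.
  move=> lN; apply: le_trans (M0P l lN).
  rewrite lerD ?pow_beta_leq //; last by lia.
  rewrite bvalD [X in _ * X]bval_zero ?mulr0 ?addr0; last first.
    by move=> j jM; rewrite splice_zeros_ge //; lia.
  rewrite (@eq_bval _ x _ (n - l%:Z)) // => j jl.
  by rewrite /splice ifT; [congr x|]; lia.
move=> l; have [lM|lM] := leqP l M.
  rewrite bval_zero ?add0r ?pow_beta_le1 // => j jl.
  by rewrite splice_zeros_ge //; lia.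
have [lN|lN] := leqP (l - M) `|n - a|%N.
  have -> : l = ((l - M) + M)%N by lia.
  exact: small.
have [na|an] := leP n a.
  rewrite bval_zero ?add0r ?pow_beta_le1 // => j jl.
  by rewrite /splice; case: ifP => // ?; rewrite xa //; lia.
have -> : l = ((l - M - `|n - a|%N) + (`|n - a|%N + M))%N by lia.
apply: closed_skip; last exact: small.
by move=> j jl; rewrite /splice; case: ifP => // ?; rewrite xa //; lia.
Qed.

(* A periodic word other than 0 gets a nonzero digit within the next period, so
   writing zeros instead strictly decreases every tail. *)
Lemma closed_at_periodic x (P : nat) (n : int) : admissible x -> (0 < P)%N ->
  (forall i, x (i + P%:Z) = x i) -> closed_at (splice x n zeros) (n + P%:Z).
Proof.
move=> adm P0 per l; have [lP|lP] := leqP l P.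
  rewrite bval_zero ?add0r ?pow_beta_le1 // => j jl.
  by rewrite splice_zeros_ge //; lia.
have -> : l = ((l - P) + P)%N by lia.
move: (l - P)%N => {lP}l.
rewrite bvalD [X in _ * X]bval_zero ?mulr0 ?addr0; last first.
  by move=> j jM; rewrite splice_zeros_ge //; lia.
rewrite (@eq_bval _ x _ (n - l%:Z)); last first.
  by move=> j jl; rewrite /splice ifT; [congr x|]; lia.
have [[j [jP xj]]|none] := pselect (exists j, (j < P)%N /\ x (n + j%:Z) != 0%N).
  apply: ltW; apply: le_lt_trans (adm (n - l%:Z) (l + P)%N).
  rewrite bvalD lerD2l exprD invfM ler_pM2l ?pow_beta_gt0 //.
  by rewrite subrK; exact: bval_nonzero jP xj.
rewrite bval_zero ?add0r ?pow_beta_le1 // => j jl.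
apply/eqP/negPn/negP => xj; apply: none.
(* The offset from [n] of the position in [[n, n + P)] congruent to [n - l + j] modulo [P]. *)
exists `|(j%:Z - l%:Z) %% P|%Z%N; split; first by have := ltz_pmod (j%:Z - l%:Z) (P0 : 0 < P%:Z); lia.
rewrite -(periodic_mul per ((j%:Z - l%:Z) %/ P)%Z).
have := divz_eq (j%:Z - l%:Z) P; have := modz_ge0 (j%:Z - l%:Z) (_ : P%:Z != 0).
move=> /(_ ltac:(lia)) ? E; rewrite -addrA gez0_abs // [X in n + X]addrC -E.
by rewrite addrCA addrC.
Qed.

(** A block is cut at the next multiple of [P]: the first piece is a suffix of the closed word, the
    shorter rest has value below 1 by induction. *)
Lemma admissible_periodize x (P : nat) : (0 < P)%N -> closed_at x P%:Z ->
  admissible (fun i => x (i %% P)%Z).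
Proof.
move=> P0 cl i n; have [m] := ubnP n; elim: m => // m IH in i n *; rewrite ltnS => nm.
have a0 : 0 <= (i %% P)%Z by rewrite modz_ge0 //; lia.
have aP : (i %% P)%Z < P by rewrite ltz_pmod.
have [l lE] : exists l : nat, P%:Z = (i %% P)%Z + l%:Z by exists `|P%:Z - (i %% P)%Z|%N; lia.
have low j : (j < l)%N -> ((i + j%:Z) %% P)%Z = (i %% P)%Z + j%:Z.
  by move=> jl; rewrite -modzDml modz_small //; lia.
have [nl|ln] := leqP n l.
  rewrite (@eq_bval _ x _ (i %% P)%Z); first by apply: (closed_bval_lt1 cl); lia.
  by move=> j jn; rewrite low //; lia.
have -> : n = (l + (n - l))%N by lia.
rewrite bvalD (@eq_bval _ x _ (P%:Z - l%:Z)); last first.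
  by move=> j jn; rewrite low //; congr x; lia.
apply: lt_le_trans (cl l); rewrite ltrD2l -[ltRHS]mulr1 ltr_pM2l ?pow_beta_gt0 //.
by apply: IH; lia.
Qed.

End Expansions.

(** * Birkhoff sums *)

Section Points.
Variables (R : realType) (beta : R).
Hypothesis hbeta : 1 < beta.
Local Notation X := (beta_shift beta).
Local Notation shift := (@left_shift R beta).
Implicit Types (x y z p q : X) (m n : nat).

Definition digits x : int -> nat := fun i => nat_of_ord (x i).

Lemma digits_inj x y : digits x =1 digits y -> x = y.
Proof. by move=> h; apply: coord_inj => i; apply: ord_inj; exact: h. Qed.

Lemma digits_admissible x : admissible beta (digits x).
Proof. by apply/(admissible_two_sidedP hbeta); have := set_valP x. Qed.

Lemma admissible_point (z : int -> nat) : admissible beta z ->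
  exists x, digits x = z.
Proof.
move=> adm; pose z' : int -> digit beta := fun i => inord (z i).
have z'E : (fun i => nat_of_ord (z' i)) = z.
  by apply/funext => i; rewrite inordK // admissible_digit.
have zX : z' \in two_sided_beta_shift beta.
  by apply/mem_set/(admissible_two_sidedP hbeta); rewrite z'E.
by exists (exist _ z' zX).
Qed.

Lemma digits_iter m x i : digits (iter m shift x) i = digits x (i + m%:Z).
Proof. by rewrite -shiftz_nat. Qed.

Lemma digits_periodic p (P : nat) : iter P shift p = p <->
  forall i, digits p (i + P%:Z) = digits p i.
Proof.
split=> [h i|h]; first by rewrite -digits_iter h.
by apply: digits_inj => i; rewrite digits_iter.
Qed.

Variable r : X -> R.

Definition bsum n x : R := \sum_(j < n) r (iter j shift x).

Lemma bsumD m n x : bsum (m + n) x = bsum m x + bsum n (iter m shift x).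
Proof.
rewrite /bsum big_split_ord /=; congr (_ + _).
by apply: eq_bigr => j _; rewrite -iterD addnC.
Qed.

Lemma bsum_mul p (P : nat) m : iter P shift p = p ->
  bsum (m * P) p = m%:R * bsum P p.
Proof.
move=> per; elim: m => [|m IH]; first by rewrite mul0n mul0r /bsum big_ord0.
by rewrite mulSn bsumD per IH -[m.+1]addn1 natrD; ring.
Qed.

(** The least period divides every period; this carries the lattice condition over to arbitrary
    periods. *)
Lemma bsum_least_period p (P : nat) : (0 < P)%N -> iter P shift p = p ->
  exists2 m, (0 < m)%N & bsum P p = m%:R * bsum (least_period p) p.
Proof.
move=> P0 per; rewrite /least_period.
case: pselect => [h|[]]; last by exists P; rewrite P0 per eqxx.
case: ex_minnP => l /andP[l0 /eqP lper] lmin.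
have iter_mul m : iter (m * l) shift p = p.
  by elim: m => //= m IH; rewrite mulSn iterD IH.
have rem0 : (P %% l)%N = 0%N.
  apply/eqP; rewrite -leqn0 leqNgt; apply/negP => rem_gt0.
  have rper : iter (P %% l) shift p = p.
    by rewrite -[RHS]per [in RHS](divn_eq P l) addnC iterD iter_mul.
  have := lmin (P %% l)%N; rewrite rem_gt0 rper eqxx => /(_ isT).
  by rewrite leqNgt ltn_mod l0.
have PE : P = (P %/ l * l)%N by rewrite {1}(divn_eq P l) rem0 addn0.
exists (P %/ l)%N; last by rewrite {1}PE bsum_mul.
by rewrite divn_gt0 // dvdn_leq // /dvdn rem0.
Qed.

Lemma least_periodP p : periodic_point p ->
  (0 < least_period p)%N /\ iter (least_period p) shift p = p.
Proof.
rewrite /least_period; case: pselect => // h _.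
by case: ex_minnP => l /andP[? /eqP].
Qed.

Definition walters_at (eps : R) (k : nat) := forall n x y,
  (forall i : int, - k%:Z <= i <= n%:Z + k%:Z -> x i = y i) ->
  `|bsum n x - bsum n y| < eps.

Lemma waltersP eps : walters r -> 0 < eps -> exists k, walters_at eps k.
Proof.
move=> w /w [k hk]; exists k => n x y h.
by rewrite /bsum -sumrB; exact: hk.
Qed.

Lemma walters_at_iter eps k n x y (a b : nat) : walters_at eps k ->
  (forall i : int, - k%:Z <= i <= n%:Z + k%:Z ->
     digits x (i + a%:Z) = digits y (i + b%:Z)) ->
  `|bsum n (iter a shift x) - bsum n (iter b shift y)| < eps.
Proof.
move=> w h; apply: w => i ik; apply: ord_inj.
by rewrite -!/(digits _ _) !digits_iter h.
Qed.

(** [z'] reads as [z] with [m] periods of [q] inserted at [a]. Cut at [a] and [a + m * P], the sum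
    has three pieces, each off by less than [eps] whatever [m] is. *)
Lemma bsum_insert eps k (z z' q : X) (P m a n : nat) :
  walters_at eps k -> iter P shift q = q -> (a <= n)%N ->
  (forall i : int, - k%:Z <= i <= a%:Z + k%:Z -> digits z' i = digits z i) ->
  (forall i : int, - k%:Z <= i <= (m * P)%:Z + k%:Z ->
     digits z' (i + a%:Z) = digits q i) ->
  (forall i : int, a%:Z - k%:Z <= i <= n%:Z + k%:Z ->
     digits z' (i + (m * P)%:Z) = digits z i) ->
  `|bsum (n + m * P) z' - (bsum n z + m%:R * bsum P q)| < 3 * eps.
Proof.
move=> w per an h1 h2 h3.
have e1 : `|bsum a z' - bsum a z| < eps.
  apply: (@walters_at_iter eps k a z' z 0 0) => // i ik.
  by rewrite !addr0 h1.
have e2 : `|bsum (m * P) (iter a shift z') - bsum (m * P) q| < eps.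
  apply: (@walters_at_iter eps k _ z' q a 0) => // i ik.
  by rewrite !addr0 h2.
have e3 : `|bsum (n - a) (iter (a + m * P) shift z') - bsum (n - a) (iter a shift z)| < eps.
  apply: walters_at_iter w _ => i ik.
  by rewrite PoszD addrA h3 //; lia.
have -> : (n + m * P = a + m * P + (n - a))%N by lia.
rewrite {2}(_ : n = (a + (n - a))%N); last by lia.
rewrite !bsumD -bsum_mul //.
by move: e1 e2 e3; rewrite !ltr_norml; lra.
Qed.

(** * Periodic closing and connecting words *)

Lemma zero_point : exists o, digits o = zeros.
Proof. exact/admissible_point/admissible_zeros. Qed.

Lemma periodic_zero o : digits o = zeros -> iter 1 shift o = o.
Proof. by move=> oE; apply/digits_periodic => i; rewrite oE. Qed.

(** The window of [x] from [-K] to [n + K] is followed by closing zeros and repeated. For [n] steps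
    [p] follows [x]; in the other [m] steps only zeros are seen within distance [k]. *)
Lemma periodic_closing eps k K (o x : X) n :
  walters_at eps k -> (k <= K)%N -> digits o = zeros ->
  (forall i : int, - K%:Z <= i <= K%:Z -> digits x i = 0%N) ->
  (forall i : int, - K%:Z <= i <= K%:Z -> digits x (i + n%:Z) = 0%N) ->
  exists p (Q m : nat), [/\ (0 < Q)%N, iter Q shift p = p, digits p 0 = 0%N &
    `|bsum Q p - (bsum n x + m%:R * bsum 1 o)| < 2 * eps].
Proof.
move=> w kK oE x0 xn.
pose x1 := splice zeros 0 (fun i => digits x (i + - K%:Z)).
have x1_adm : admissible beta x1.
  apply: admissible_splice => //; first exact: closed_zeros.
  exact: admissible_shift (digits_admissible x).
have x1_neg i : i < 0 -> x1 i = 0%N by rewrite /x1 /splice => ->.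
have [M0 /(_ M0 (leqnn _))] :=
  closed_at_finite hbeta (n%:Z + K%:Z + K%:Z + 1) x1_adm x1_neg.
set x2 := splice x1 _ zeros => cl.
(* [n + 2K + 1] entries of the window, then [M0] closing zeros. *)
pose Q := (n + K + K + 1 + M0)%N.
have Q0 : (0 < Q)%N by rewrite /Q; lia.
have {}cl : closed_at beta x2 Q by move: cl; rewrite /Q; congr closed_at; lia.
have [p pE] := admissible_point (admissible_shift K%:Z (admissible_periodize hbeta Q0 cl)).
have pmod (j i : int) : 0 <= j + K%:Z < Q%:Z -> i = j \/ i = j + Q%:Z ->
    digits p i = x2 (j + K%:Z).
  move=> jQ ij; rewrite pE; congr x2; case: ij => ->; last first.
    by rewrite addrAC modzDr modz_small.
  by rewrite modz_small.
have x2E i : x2 (i + K%:Z) = if (- K%:Z <= i) && (i <= n%:Z + K%:Z) then digits x i else 0%N.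
  rewrite /x2 /x1 /splice /zeros.
  by do ?[case: ifP => ?]; try lia; congr digits; lia.
have per : iter Q shift p = p.
  by apply/digits_periodic => i; rewrite pE /= addrAC modzDr.
exists p, Q, (Q - n)%N; split=> //.
  rewrite (@pmod 0) //; first by rewrite x2E; case: ifP => // ?; apply: x0; lia.
  - rewrite /Q; lia.
  - by left.
have e1 : `|bsum n p - bsum n x| < eps.
  apply: (@walters_at_iter eps k n p x 0 0) => // i ik.
  rewrite !addr0 (@pmod i); [|rewrite /Q; lia|by left].
  by rewrite x2E ifT //; lia.
have e2 : `|bsum (Q - n) (iter n shift p) - bsum (Q - n) o| < eps.
  apply: (@walters_at_iter eps k _ p o n 0) => // i ik.
  (* From [Q - K] on, [p] repeats the start of its window, where [x] is zero again. *)
  rewrite oE /zeros; have [iQ|iQ] := ltP (i + n%:Z + K%:Z) Q%:Z.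
    rewrite (@pmod (i + n%:Z)); [|by lia|by left].
    rewrite x2E; case: ifP => // ?; apply: xn; lia.
  rewrite (@pmod (i + n%:Z - Q%:Z)); [|by move: ik; rewrite /Q in iQ *; lia|by right; lia].
  rewrite x2E; case: ifP => // ?; apply: x0; move: ik; lia.
have nQ : (n <= Q)%N by rewrite /Q; lia.
rewrite -bsum_mul ?periodic_zero // muln1 -[in bsum Q _](subnKC nQ) bsumD.
by move: e1 e2; rewrite !ltr_norml; lra.
Qed.

(** [z] reads [x], a run of zeros, a run of [p], [P] closing zeros, then [y]. The runs grow by [m2]
    zeros and [m1] periods; each growth costs less than [3 * eps] relative to [m1 = m2 = 0], whose
    sum is [C]. *)
Lemma connecting_family eps k K (o x y p : X) (P : nat) :
  walters_at eps k -> digits o = zeros -> (0 < P)%N -> iter P shift p = p ->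
  exists (n0 : nat) (C : R), forall m1 m2, exists z,
    [/\ forall i : int, - K%:Z <= i <= K%:Z -> digits z i = digits x i,
        forall i : int, - K%:Z <= i <= K%:Z ->
          digits z (i + (n0 + m2 + m1 * P)%:Z) = digits y i &
        `|bsum (n0 + m2 + m1 * P) z
            - (C + m1%:R * bsum P p + m2%:R * bsum 1 o)| < 6 * eps].
Proof.
move=> w oE P0 perp.
pose K0 := maxn K k.
have [KK0 kK0] : (K <= K0)%N /\ (k <= K0)%N by rewrite leq_maxl leq_maxr.
pose x1 := splice zeros (- K0%:Z) (fun i => digits x (i + - K0%:Z)).
have x1_adm : admissible beta x1.
  apply: admissible_splice => //; first exact: closed_zeros.
  exact: admissible_shift (digits_admissible x).
have x1_neg i : i < - K0%:Z -> x1 i = 0%N by rewrite /x1 /splice => ->.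
have [M0 clM] := closed_at_finite hbeta (K0%:Z + 1) x1_adm x1_neg.
set x2 := splice x1 _ zeros in clM.
pose N := (K0 + 1 + M0 + 2 * k + 1)%N.
pose W := (k * P)%N.
have kW : (k <= W)%N by rewrite /W leq_pmulr.
have /digits_periodic/periodic_mul perM := perp.
pose tail m1 := splice (splice (digits p) (W + W + P + m1 * P)%:Z zeros)
  ((W + W + P + m1 * P)%:Z + P%:Z) (fun i => digits y (i + - K0%:Z)).
have tail_adm m1 : admissible beta (tail m1).
  apply: admissible_splice => //; last exact: admissible_shift (digits_admissible y).
  apply: closed_at_periodic => //; first exact: digits_admissible.
  by apply/digits_periodic.
have /choice [zf zfE] (m : nat * nat) :
    exists z, digits z = splice x2 (N + m.2)%:Z (tail m.1).
  apply: admissible_point; apply: admissible_splice => //.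
  rewrite (_ : _%:Z = K0%:Z + 1 + (M0 + 2 * k + 1 + m.2)%:Z); last by rewrite /N; lia.
  apply: clM; lia.
pose n0 := (N + (W + W + P) + P + K0)%N.
exists n0, (bsum n0 (zf (0, 0)%N)) => m1 m2; exists (zf (m1, m2)).
split.
- move=> i iK; rewrite zfE /= /splice ifT; last by rewrite /N; lia.
  by rewrite /x2 /x1 /splice ifT ?ifF; [congr digits| |]; lia.
- move=> i iK; rewrite zfE /= /n0 /splice ifF; last by lia.
  by rewrite /tail /splice ifF; [congr digits|]; lia.
have e1 : `|bsum (n0 + m2 * 1) (zf (0, m2)%N) - (bsum n0 (zf (0, 0)%N) + m2%:R * bsum 1 o)| < 3 * eps.
  apply: (@bsum_insert eps k _ _ _ 1 m2 (N - k - 1)) => //.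
  - exact: periodic_zero.
  - by rewrite /n0; lia.
  - move=> i ik; rewrite !zfE /= /splice !ifT //; move: ik; rewrite /N; lia.
  - move=> i ik; rewrite zfE oE /= /splice ifT; last by move: ik; rewrite /N; lia.
    by rewrite /x2 /splice ifF //; move: ik; rewrite /N; lia.
  - move=> i ik; rewrite !zfE /= /splice muln1; have [iN|iN] := ltP i N%:Z.
      rewrite !ifT; [|lia..]; rewrite /x2 /splice !ifF //; move: ik; rewrite /N; lia.
    rewrite !ifF; [|lia..]; congr (tail 0%N); lia.
have e2 : `|bsum (n0 + m2 + m1 * P) (zf (m1, m2)%N) -
    (bsum (n0 + m2) (zf (0, m2)%N) + m1%:R * bsum P p)| < 3 * eps.
  apply: (@bsum_insert eps k _ _ _ P m1 (N + m2 + W)) => //.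
  - by rewrite /n0; lia.
  - move=> i ik; rewrite !zfE /= /splice; case: ifP => // iN.
    by rewrite /tail /splice !ifT //; lia.
  - move=> i ik; rewrite !zfE /= {1}/splice ifF; last by lia.
    rewrite /tail /splice !ifT; [|lia..].
    by rewrite -[RHS](perM k%:Z); congr digits; rewrite /W; lia.
  - move=> i ik; rewrite !zfE /= /splice !ifF; [|lia..].
    rewrite /tail /splice mul0n addn0.
    have [h1|h1] := ltP (i - (N + m2)%:Z) (W + W + P)%:Z.
      rewrite !ifT; [|lia..].
      by rewrite -[RHS](perM m1%:Z); congr digits; lia.
    have [h2|h2] := ltP (i - (N + m2)%:Z) ((W + W + P)%:Z + P%:Z).
      by rewrite ifT ?ifF //; lia.
    by rewrite ifF; [congr digits|]; lia.
by move: e1 e2; rewrite muln1 !ltr_norml; lra.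
Qed.

End Points.

(** * Values of the periods *)

Section Semigroups.
Variable R : realType.
Implicit Types a b eta : R.

(** Take [J] copies of [v] and as many [b] as fit below [t]. The gap, less than [b], is filled by
    exchanging copies of [v] for [u], each adding [d < eta]; [J] copies suffice because
    [J * d > b]. *)
Lemma eventually_dense a b eta (i j k l : nat) : 0 < a -> 0 < b ->
  0 < (i%:R * a + j%:R * b) - (k%:R * a + l%:R * b) < eta ->
  exists T, forall t, T <= t ->
    exists m1 m2 : nat, `|m1%:R * a + m2%:R * b - t| < eta.
Proof.
move=> a0 b0; set u := i%:R * a + _; set v := k%:R * a + _.
move=> /andP[d0 de]; set d := u - v in d0 de.
pose J := (Num.truncn (b / d)).+1.
have v0 : 0 <= v by rewrite addr_ge0 // mulr_ge0 // ltW.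
exists (J%:R * v) => t Tt.
have tb : 0 <= (t - J%:R * v) / b by rewrite divr_ge0 ?subr_ge0 // ltW.
pose m := Num.truncn ((t - J%:R * v) / b).
have /andP[m1 m2] : m%:R <= (t - J%:R * v) / b < m.+1%:R by exact: truncn_itv.
rewrite ler_pdivlMr // in m1; rewrite ltr_pdivrMr // in m2.
pose s := t - J%:R * v - m%:R * b.
have sb : 0 <= s < b by rewrite /s; move: m2; rewrite -natr1 mulrDl; lra.
have /andP[s0 _] := sb.
have sd : 0 <= s / d by apply: divr_ge0 => //; exact: ltW.
pose c := Num.truncn (s / d).
have /andP[c1 c2] : c%:R <= s / d < c.+1%:R by exact: truncn_itv.
rewrite ler_pdivlMr // in c1; rewrite ltr_pdivrMr // in c2.
have cJ : (c <= J)%N.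
  rewrite /c /J leqW // le_truncn // ler_pM2r ?invr_gt0 //.
  by case/andP: sb => _ /ltW.
exists ((J - c) * k + c * i)%N, ((J - c) * l + c * j + m)%N.
rewrite !natrD !natrM natrB //.
rewrite (_ : _ - t = c%:R * d - s); last by rewrite /s /d /u /v; ring.
by move: c2; rewrite -natr1 ltr_norml mulrDl; lra.
Qed.

(** Two of the [N + 1] fractional parts of [j * a / b] share an interval of length [1 / N], so the
    corresponding numbers [j * a - c j * b] differ by less than [eta]. A nonzero difference gives
    the first alternative, equality the second. *)
Lemma dirichlet a b eta (N : nat) : 0 < a -> 0 < b -> (0 < N)%N -> b < eta * N%:R ->
  (exists i j k l : nat,
     0 < (i%:R * a + j%:R * b) - (k%:R * a + l%:R * b) < eta) \/
  exists (q : nat) (p : int), (0 < q <= N)%N /\ q%:R * a = p%:~R * b.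
Proof.
move=> a0 b0 N0 bN.
pose c (j : nat) := Num.truncn (j%:R * a / b).
pose f (j : nat) := N%:R * (j%:R * a / b - (c j)%:R).
have f_itv j : 0 <= f j < N%:R.
  have /truncn_itv/andP[h1 h2] : 0 <= j%:R * a / b by rewrite divr_ge0 ?mulr_ge0 // ltW.
  rewrite /f mulr_ge0 ?subr_ge0 //= -[ltRHS]mulr1 ltr_pM2l ?ltr0n //.
  by rewrite ltrBlDl natr1.
have fN (j : 'I_N.+1) : (Num.truncn (f j) < N)%N.
  by have /andP[h1 h2] := f_itv j; rewrite truncn_lt_nat.
have : ~ injective (fun j => Ordinal (fN j)).
  by move=> /leq_card; rewrite !card_ord ltnn.
have close (i j : nat) : Num.truncn (f i) = Num.truncn (f j) ->
    i%:R * a - (c i)%:R * b - (j%:R * a - (c j)%:R * b) < eta.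
  move=> fE; have /andP[h1 _] := f_itv i; have /andP[h2 _] := f_itv j.
  have fij : f i - f j < 1.
    have /andP[_ ] := truncn_itv h1; have /andP[+ _] := truncn_itv h2.
    by rewrite fE -natr1; lra.
  have : N%:R * (i%:R * a - (c i)%:R * b - (j%:R * a - (c j)%:R * b)) = b * (f i - f j).
    by rewrite /f; field; rewrite gt_eqF.
  move=> E; rewrite -(@ltr_pM2l _ N%:R) ?ltr0n // E [ltRHS]mulrC.
  by apply: lt_trans bN; rewrite -[ltRHS]mulr1 ltr_pM2l.
move=> /existsNP[i /existsNP[j /not_implyP[/(congr1 val) /= ij ne]]].
wlog lt_ij : i j ij ne / (i < j)%N.
  move=> W; have [/W|/W|/val_inj//] := ltngtP i j; first by apply.
  by apply=> // /esym.
have [lt|gt|eq] := ltgtP (i%:R * a - (c i)%:R * b) (j%:R * a - (c j)%:R * b).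
- left; exists j, (c i), i, (c j).
  by have := close _ _ (esym ij); move: lt; lra.
- left; exists i, (c j), j, (c i).
  by have := close _ _ ij; move: gt; lra.
right; exists (j - i)%N, ((c j)%:Z - (c i)%:Z); split.
  by have := ltn_ord j; lia.
by rewrite natrB ?(ltnW lt_ij) // intrD intrN -!pmulrn; move: eq; lra.
Qed.

(** If density fails for one [eta], every [a] in [A] satisfies [q * a = p * b] with [q <= N], where
    [N] depends only on [b] and [eta]; so [b / N!] is a common unit. *)
Lemma lattice_or_dense (A : set R) b : 0 < b -> (forall a, A a -> 0 < a) ->
  (exists2 delta, 0 < delta & forall a, A a -> exists m : int, a = delta * m%:~R) \/
  (forall eta, 0 < eta -> exists2 a, A a & exists T, forall t, T <= t ->
    exists m1 m2 : nat, `|m1%:R * a + m2%:R * b - t| < eta).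
Proof.
move=> b0 A0; have [|none] := pselect (forall eta, 0 < eta -> exists2 a, A a & exists T, forall t, T <= t ->
    exists m1 m2 : nat, `|m1%:R * a + m2%:R * b - t| < eta); first by right.
left; move/existsNP: none => [eta /not_implyP[eta0 none]].
pose N := (Num.truncn (b / eta)).+1.
have bN : b < eta * N%:R by rewrite mulrC -ltr_pdivrMr // truncnS_gt.
exists (b / (N`!)%:R); first by rewrite divr_gt0 // ltr0n fact_gt0.
move=> a Aa; have a0 := A0 _ Aa.
have [[i [j [k [l h]]]]|[q [p [/andP[q0 qN] qp]]]] := dirichlet a0 b0 (isT : (0 < N)%N) bN.
  by case: none; exists a => //; exact: eventually_dense h.
have /dvdnP[e eE] : (q %| N`!)%N by apply: dvdn_fact; rewrite q0.
exists (p * e%:Z); rewrite eE intrM natrM -pmulrn.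
have q1 : q%:R != 0 :> R by rewrite pnatr_eq0 -lt0n.
have e1 : e%:R != 0 :> R.
  by rewrite pnatr_eq0; apply/eqP => e0; have := fact_gt0 N; rewrite eE e0 mul0n.
apply: (mulfI q1); rewrite qp; field.
by rewrite q1 e1.
Qed.

End Semigroups.

(** * The suspension flow *)

Section Flow.
Variables (R : realType) (beta : R).
Hypothesis hbeta : 1 < beta.
Local Notation X := (beta_shift beta).
Local Notation shift := (@left_shift R beta).
Implicit Types (x y z p q : X) (m n K : nat).

Definition agree K x y :=
  forall i : int, - K%:Z <= i <= K%:Z -> digits y i = digits x i.

Lemma agree_leq K1 K2 x y : (K1 <= K2)%N -> agree K2 x y -> agree K1 x y.
Proof. by move=> K12 xy i iK; apply: xy; lia. Qed.

Lemma ball_agree x y (e : R) : ball x e y <-> shift_dist x y < e.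
Proof. by rewrite ballEmdist. Qed.

Lemma agree_nbhs K x : nbhs x (agree K x).
Proof.
apply/nbhs_ballP; exists (2 ^- K); first by rewrite /= invr_gt0 exprn_gt0.
move=> y /ball_agree xy i iK; apply: contrapT => ne.
have : Defs.coord x i <> Defs.coord y i by move=> xyi; apply: ne; rewrite /digits xyi.
move=> /shift_dist_ge /le_lt_trans /(_ xy).
by rewrite ltf_pV2 ?posrE ?exprn_gt0 // ltr_eXn2l ?ltr1n //; lia.
Qed.

Lemma nbhs_agree x (A : set X) : nbhs x A -> exists K, agree K x `<=` A.
Proof.
move=> /nbhs_ballP[e /= e0 eA].
have [K Ke] := @pow_beta_small R 2 (ltr1n _ 2) e e0.
exists K => y xy; apply: eA; apply/ball_agree.
have [[_ ->] //|[i [ne ->]]] := shift_distP x y.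
apply: lt_le_trans Ke.
rewrite ltf_pV2 ?posrE ?exprn_gt0 // ltr_eXn2l ?ltr1n // ltnNge.
by apply/negP => iK; apply: ne; apply: ord_inj; rewrite -/(digits _ _) -xy //; lia.
Qed.

Variable r : X -> R.
Hypothesis r_gt0 : forall x, 0 < r x.
Hypothesis r_walters : walters r.

(** The Walters property for sums of length 1, whose window reaches [1 + k]. *)
Lemma roof_continuous x (eps : R) : 0 < eps ->
  exists K, forall y, agree K x y -> `|r y - r x| < eps.
Proof.
move=> /(waltersP r_walters)[k kP]; exists k.+1 => y xy.
have := kP 1%N y x; rewrite /bsum !big_ord1; apply => i ik.
by apply: ord_inj; apply: xy; lia.
Qed.

Definition box K x (s eta : R) : set (under_roof r) :=
  [set u | agree K x (base_point u) /\ `|height u - s| < eta].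

Lemma open_agree K x : open (agree K x).
Proof.
rewrite openE => y xy; apply: filterS (agree_nbhs K y) => z yz i iK.
by rewrite yz // xy.
Qed.

Lemma open_box K x s eta : open (box K x s eta).
Proof.
exists (agree K x `*` ball s eta).
  rewrite openE => -[y t] [/= xy st].
  exists (agree K x, ball s eta) => //; split; apply: open_nbhs_nbhs; split => //.
    exact: open_agree.
  by apply: ball_open; exact: le_lt_trans st.
apply/seteqP; split=> u /=; rewrite /box /= /ball /= distrC //.
Qed.

Lemma under_roofP x (s : R) : 0 <= s <= r x ->
  exists u : under_roof r, base_point u = x /\ height u = s.
Proof. by move=> h; exists (exist _ (x, s) (mem_set h)). Qed.

(** The given point may lie on the floor or the roof; its height is first moved towards the middle
    of the fibre. Continuity of the roof then fits a cylinder times an interval under it, so points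
    can be placed freely. *)
Lemma open_suspension_box (U : set (suspension r)) : open U -> U !=set0 ->
  exists K x s eta, [/\ 0 < eta,
    forall z s', agree K x z -> `|s' - s| < eta -> 0 <= s' <= r z &
    box K x s eta `<=` suspension_pi (r := r) @^-1` U].
Proof.
move=> oU [q Uq]; have : open (suspension_pi (r := r) @^-1` U) by exact: oU.
case=> O oO OE.
have [u uq] : exists u, q = suspension_pi u by exists (repr q); rewrite /suspension_pi reprK.
have Ou : O (\val u).
  suff : (set_val @^-1` O) u by [].
  by rewrite OE /= -uq.
have /= [[A B] [/= nA nB] ABO] : nbhs (\val u) O by exact: open_nbhs_nbhs.
have [K1 K1A] := nbhs_agree nA.
move: nB => /nbhs_ballP[e /= e0 eB].
pose x := base_point u.
have /andP[s0 sr] : 0 <= height u <= r x by have := set_valP u.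
have rx := r_gt0 x.
(* The weight of the midpoint, chosen so that the height moves by at most [e / 4]. *)
pose c := Num.min 1 (e / (2 * r x)).
have c0 : 0 < c by rewrite lt_min ltr01 divr_gt0 // mulr_gt0.
have c1 : c <= 1 by rewrite ge_min lexx.
have cr : c * r x <= e / 2.
  have : c <= e / (2 * r x) by rewrite ge_min lexx orbT.
  by rewrite ler_pdivlMr ?mulr_gt0 //; lra.
pose s := (1 - c) * height u + c * (r x / 2).
have s_gt0 : 0 < s by rewrite /s; nra.
have s_lt : s < r x by rewrite /s; nra.
have s_near : `|s - height u| <= e / 4 by rewrite ler_norml /s; apply/andP; split; nra.
have gap : 0 < (r x - s) / 2 by lra.
have [K2 K2P] := roof_continuous x gap.
pose eta := Num.min s (Num.min ((r x - s) / 2) (e / 2)).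
have [eta1 [eta2 eta3]] : eta <= s /\ eta <= (r x - s) / 2 /\ eta <= e / 2.
  by rewrite /eta !ge_min !lexx !orbT.
exists (maxn K1 K2), x, s, eta; split.
- by rewrite !lt_min s_gt0 gap divr_gt0.
- move=> z s' xz; rewrite ltr_norml => /andP[h1 h2].
  have /K2P := agree_leq (leq_maxr K1 K2) xz.
  by rewrite ltr_norml; lra.
move=> v [xv hv] /=.
suff : (suspension_pi (r := r) @^-1` U) v by [].
rewrite -OE /=; apply: ABO; split => /=.
  exact/K1A/(agree_leq (leq_maxl K1 K2) xv).
apply: eB; rewrite /ball /=; move: hv s_near; rewrite distrC.
by rewrite -!/(height _) !ltr_norml ler_norml; lra.
Qed.

Lemma birkhoff_nat x n : birkhoff r x n = bsum r n x.
Proof. by apply: eq_bigr => j _; rewrite shiftz_nat. Qed.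

(** * Lengths of closed orbits through [0] and mixing *)

Definition zero_periods : set R :=
  [set a | exists p, [/\ periodic_point p, p 0 = ord0 & a = bsum r (least_period p) p]].

Lemma zero_periods_gt0 a : zero_periods a -> 0 < a.
Proof.
move=> [p [/least_periodP[l0 _] _ ->]]; rewrite /bsum.
case: (least_period p) l0 => // l _; rewrite big_ord_recl ltr_wpDr //.
by apply: sumr_ge0 => j _; exact: ltW.
Qed.

(** The orbit starts over the connecting word at height exactly [s]; [m1] and [m2] are chosen so
    that at time [t] it is near [y], at a height within [eta2] of [s']. *)
Lemma mixing_of_dense (z0 : X) : digits z0 = zeros ->
  (forall eta, 0 < eta -> exists2 a, zero_periods a & exists T, forall t, T <= t ->
    exists m1 m2 : nat, `|m1%:R * a + m2%:R * bsum r 1 z0 - t| < eta) ->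
  topologically_mixing r.
Proof.
move=> zE dense U V oU oV U0 V0.
have [K1 [x [s [eta1 [eta1_gt0 roof1 box1]]]]] := open_suspension_box oU U0.
have [K2 [y [s' [eta2 [eta2_gt0 roof2 box2]]]]] := open_suspension_box oV V0.
(* The error [6 * (eta2 / 12)] of the family is half of [eta2]; the other half goes to density. *)
have [k kP] : exists k, walters_at r (eta2 / 12) k.
  by apply: waltersP => //; rewrite divr_gt0.
have [|a [p [perp _ aE]] [T TP]] := dense (eta2 / 2); first by rewrite divr_gt0.
have [P0 perP] := least_periodP perp.
have [n0 [C family]] := connecting_family hbeta (maxn K1 K2) x y kP zE P0 perP.
exists (T + C + s' - s) => t Tt.
have [|m1 [m2 m12]] := TP (t + s - s' - C); first by lra.
have [z [zx zy zsum]] := family m1 m2.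
move: zx zy zsum; set n := (n0 + m2 + _)%N => zx zy zsum.
rewrite -aE in zsum.
have xz : agree K1 x z by apply: agree_leq (leq_maxl K1 K2) zx.
have yz : agree K2 y (iter n shift z).
  by apply: (agree_leq (leq_maxr K1 K2)) => i iK; rewrite digits_iter zy.
have hs : `|t + s - bsum r n z - s'| < eta2.
  by move: zsum m12; rewrite !ltr_norml; lra.
have hs0 : `|s - s| < eta1 by rewrite subrr normr0.
have [u [uz us]] := under_roofP (roof1 z s xz hs0).
have [v [vz vs]] := under_roofP (roof2 _ _ yz hs).
exists (suspension_pi v); split; last by apply: box2; rewrite /box /= vz vs.
exists (suspension_pi u); first by apply: box1; rewrite /box /= uz us.
exists u, v, n%:Z; split => //; first by rewrite uz vz shiftz_nat.
by rewrite uz vs us birkhoff_nat; ring.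
Qed.

(* A box meeting neither the floor nor the roof is saturated for the gluing. *)
Lemma open_box_image K x s eta :
  (forall y s', agree K x y -> `|s' - s| < eta -> 0 < s' < r y) ->
  exists2 U : set (suspension r), open U &
    forall u, U (suspension_pi u) <-> box K x s eta u.
Proof.
move=> inner; pose U : set (suspension r) := [set q | box K x s eta (repr q)].
have glue u v : glue_top u v -> box K x s eta u <-> box K x s eta v.
  move=> [hu bv hv]; split=> -[h1 h2]; have := inner _ _ h1 h2.
    by rewrite hu ltxx andbF.
  by rewrite hv ltxx.
have sat u v : clos_refl_sym_trans _ (@glue_top R beta r) u v ->
    box K x s eta u <-> box K x s eta v.
  by elim=> [? ? /glue|?|? ? _ ->|? ? ? _ -> _ ->].
have UE u : U (suspension_pi u) <-> box K x s eta u.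
  apply: sat; apply/asboolP.
  have : (repr (suspension_pi u) == u %[mod {eq_quot (glue_equivRel r)}])%qT.
    by rewrite reprK.
  by rewrite eqmodE.
exists U => //; rewrite /open /= /quotient_open.
suff -> : (\pi_(quotient_topology {eq_quot glue_equivRel r}) @^-1` U)%qT = box K x s eta.
  exact: open_box.
by apply/seteqP; split=> u /UE.
Qed.

Lemma lattice_not_mixing (delta : R) : 0 < delta ->
  (forall a, zero_periods a -> exists m : int, a = delta * m%:~R) ->
  ~ topologically_mixing r.
Proof.
move=> d0 lattice mix.
have [z0 zE] := zero_point hbeta.
have multiple p Q : (0 < Q)%N -> iter Q shift p = p -> digits p 0 = 0%N ->
    exists m : int, bsum r Q p = delta * m%:~R.
  move=> Q0 per p0; have [l _ ->] := bsum_least_period r Q0 per.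
  have [|m ->] := lattice (bsum r (least_period p) p); last first.
    by exists (l%:Z * m); rewrite intrM -pmulrn; ring.
  exists p; split => //; last exact: ord_inj.
  by exists Q; rewrite Q0 per eqxx.
have [mo moE] : exists m : int, bsum r 1 z0 = delta * m%:~R.
  by apply: multiple => //; [exact: periodic_zero|rewrite zE].
have ro := r_gt0 z0.
(* Closing costs less than [2 * (delta / 8)] and the two heights differ by less than
   [2 * eta <= delta / 4]: together less than the distance [delta / 2] from [m * delta + delta / 2]
   to the lattice. *)
have [k kP] : exists k, walters_at r (delta / 8) k.
  by apply: waltersP => //; rewrite divr_gt0.
have [|K0 K0P] := @roof_continuous z0 (r z0 / 4); first by rewrite divr_gt0.
pose K := maxn k K0.
pose eta := Num.min (delta / 8) (r z0 / 4).
have [eta1 eta2] : eta <= delta / 8 /\ eta <= r z0 / 4.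
  by rewrite /eta !ge_min !lexx orbT.
have eta0 : 0 < eta by rewrite lt_min !divr_gt0.
(* Over the cylinder the roof exceeds 3/4 of [r z0], while the heights in the box lie strictly
   between 1/4 and 3/4 of it. *)
have [y s' oy|U oU UE] := @open_box_image K z0 (r z0 / 2) eta.
  have := K0P y (agree_leq (leq_maxr k K0) oy).
  by rewrite !ltr_norml => h1 h2; apply/andP; split; lra.
have U0 : U !=set0.
  have [|u [uo us]] := @under_roofP z0 (r z0 / 2); first by lra.
  by exists (suspension_pi u); apply/UE; rewrite /box /= uo us subrr normr0.
have [T TP] := mix U U oU oU U0 U0.
pose m := (Num.truncn (T / delta)).+1.
have mT : T < m%:R * delta by rewrite -ltr_pdivrMr // truncnS_gt.
have m1 : 1 <= m%:R :> R by rewrite ler1n.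
have [|q [[q0 Uq0 [u [v [n [q0E qE uv sum]]]]] Uq]] := TP (m%:R * delta + delta / 2).
  by lra.
move: Uq0 Uq; rewrite q0E qE => /UE[ou hu] /UE[ov hv].
move: hu hv; rewrite !ltr_norml => hu hv.
have md : delta <= m%:R * delta by rewrite ler_peMl // ltW.
(* A negative [n] makes the Birkhoff sum at most 0, and the heights account for less than
   [delta / 4] of a time exceeding [delta]. *)
case: n uv sum => [n|n] uv; last first.
  have : 0 <= \sum_(j < n.+1) r (shiftz (- j.+1%:Z) (base_point u)).
    by apply: sumr_ge0 => j _; exact: ltW.
  by rewrite /birkhoff; lra.
rewrite birkhoff_nat => sum.
rewrite uv shiftz_nat in ov.
have [||p [Q [l [Q0 per p0]]]] :=
  periodic_closing hbeta (x := base_point u) (n := n) kP (leq_maxl k K0 : (k <= K)%N) zE.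
- by move=> i iK; rewrite ou // zE.
- by move=> i iK; rewrite -digits_iter ov // zE.
have [mp ->] := multiple p Q Q0 per p0.
rewrite moE ltr_norml => close.
(* An integer that the error bounds force strictly between 0 and 1. *)
pose M := mp - l%:Z * mo - m%:Z.
have ME : M%:~R = mp%:~R - l%:R * mo%:~R - m%:R :> R.
  by rewrite /M !intrD !intrN intrM -!pmulrn.
have : 0 < delta * M%:~R < delta * 1.
  by rewrite ME; apply/andP; split; lra.
rewrite pmulr_rgt0 // ltr_pM2l // ltr0z ltrz1.
by case/andP=> M0; rewrite ltNge -gtz0_ge1 M0.
Qed.

End Flow.

Theorem theorem3p6 (R : realType) (beta : R) (hbeta : 1 < beta)
    (r : beta_shift beta -> R) (hr_pos : forall x, 0 < r x)
    (hr_walters : walters r) :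
  ~ topologically_mixing r <->
  exists2 delta : R, 0 < delta &
    forall p : beta_shift beta, periodic_point p -> p 0 = ord0 ->
      exists m : int,
        \sum_(j < least_period p) r (iter j (@left_shift R beta) p)
          = delta * m%:~R.
Proof.
split=> [notmix|[delta d0 lattice]]; last first.
  apply: (lattice_not_mixing hbeta hr_pos hr_walters d0) => a [p [per p0 ->]].
  exact: lattice.
have [z0 zE] := zero_point hbeta.
have b0 : 0 < bsum r 1 z0 by rewrite /bsum big_ord1.
(* The fixed point 0^oo provides the second generator [b], the value of [r] there. *)
have [[delta d0 lattice]|dense] := lattice_or_dense b0 (zero_periods_gt0 hr_pos).
  by exists delta => // p per p0; apply: lattice; exists p.
by case: notmix; exact: (mixing_of_dense hbeta hr_pos hr_walters zE dense).
Qed.
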